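(* Let $n\ge 2$. There are exactly $2^{n-2}$ braid isotopy classes of positive $n$-th roots (i.e. exactly $2^{n-2}$ elements $\beta\in B_n$ that are positive braids with $\beta^n=\Delta_n^2$), and all of them are conjugate in $B_n$ to the standard root $\delta_n=\sigma_1\cdots\sigma_{n-1}$.
   Context: $B_n$ is the braid group on $n$ strands with standard generators $\sigma_1,\dots,\sigma_{n-1}$; braid isotopy classes of $n$-braids are the elements of $B_n$. A positive $n$-braid is one that can be written as a product of the $\sigma_i$ without inverses. $\Delta_n^2\in B_n$ denotes the (positive) full twist, the central element $\Delta_n^2=(\sigma_1\cdots\sigma_{n-1})^n$. *)

(* Defs.v *)
From HB Require Import structures.
From mathcomp Require Import all_boot.
From mathcomp Require Import boolp classical_sets functions cardinality.

Set Implicit Arguments.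
Unset Strict Implicit.
Unset Printing Implicit Defensive.

Local Open Scope quotient_scope.
Local Open Scope group_scope.

(* The group B_n is defined by Artin's presentation.  The generators are      *)
(* indexed from 0: the index i : 'I_n.-1 stands for sigma_{i+1}.  A letter    *)
(* (i, false) is a generator and (i, true) is its inverse.                    *)
Definition braid_word (n : nat) : Type := seq ('I_n.-1 * bool).

Inductive braid_equiv (n : nat) : braid_word n -> braid_word n -> Prop :=
| braid_equiv_refl w : braid_equiv w w
| braid_equiv_sym w1 w2 : braid_equiv w1 w2 -> braid_equiv w2 w1
| braid_equiv_trans w1 w2 w3 :
    braid_equiv w1 w2 -> braid_equiv w2 w3 -> braid_equiv w1 w3
| braid_equiv_cat w1 w2 w3 w4 :
    braid_equiv w1 w2 -> braid_equiv w3 w4 ->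
    braid_equiv (w1 ++ w3) (w2 ++ w4)
| braid_equiv_cancel (i : 'I_n.-1) (e : bool) :
    braid_equiv [:: (i, e); (i, ~~ e)] [::]
| braid_equiv_far (i j : 'I_n.-1) :
    (i.+1 < j)%N ->
    braid_equiv [:: (i, false); (j, false)] [:: (j, false); (i, false)]
| braid_equiv_near (i j : 'I_n.-1) :
    j = i.+1 :> nat ->
    braid_equiv [:: (i, false); (j, false); (i, false)]
                [:: (j, false); (i, false); (j, false)].

Definition braid_equivb n (w1 w2 : braid_word n) : bool :=
  `[< braid_equiv w1 w2 >].

Lemma braid_equivb_refl n : reflexive (@braid_equivb n).
Proof. by move=> w; apply/asboolP/braid_equiv_refl. Qed.

Lemma braid_equivb_sym n : symmetric (@braid_equivb n).
Proof.
by move=> w1 w2; apply/asboolP/asboolP => /braid_equiv_sym.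
Qed.

Lemma braid_equivb_trans n : transitive (@braid_equivb n).
Proof.
move=> w2 w1 w3 /asboolP h12 /asboolP h23.
by apply/asboolP; apply: braid_equiv_trans h12 h23.
Qed.

Canonical braid_equiv_rel n : equiv_rel (braid_word n) :=
  EquivRel (@braid_equivb n) (@braid_equivb_refl n) (@braid_equivb_sym n)
    (@braid_equivb_trans n).

Definition braid (n : nat) : Type := {eq_quot (@braid_equiv_rel n)}.

HB.instance Definition _ n := Choice.on (braid n).

Definition braid_of_word n (w : braid_word n) : braid n :=
  (\pi_({eq_quot (@braid_equiv_rel n)}) w)%qT.

Definition word_of_braid n (b : braid n) : braid_word n :=
  repr (b : {eq_quot (@braid_equiv_rel n)}).

Lemma word_of_braidK n : cancel (@word_of_braid n) (@braid_of_word n).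
Proof. by move=> b; apply: reprK. Qed.

Lemma braid_of_wordP n (w1 w2 : braid_word n) :
  braid_of_word w1 = braid_of_word w2 <-> braid_equiv w1 w2.
Proof.
by split=> [/eqmodP/asboolP | h] //; apply/eqmodP/asboolP.
Qed.

Definition braid_word_inv n (w : braid_word n) : braid_word n :=
  rev [seq (x.1, ~~ x.2) | x <- w].

Lemma braid_word_invK n : involutive (@braid_word_inv n).
Proof.
move=> w; rewrite /braid_word_inv map_rev revK -map_comp.
by rewrite -[RHS]map_id; apply: eq_map => -[i e] /=; rewrite negbK.
Qed.

Lemma braid_word_inv_cat n (w1 w2 : braid_word n) :
  braid_word_inv (w1 ++ w2) = braid_word_inv w2 ++ braid_word_inv w1.
Proof. by rewrite /braid_word_inv map_cat rev_cat. Qed.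

Lemma braid_equiv_invr n (w : braid_word n) :
  braid_equiv (w ++ braid_word_inv w) [::].
Proof.
elim/last_ind: w => [|w [i e] IHw]; first exact: braid_equiv_refl.
rewrite -cats1 braid_word_inv_cat /= -catA.
apply: braid_equiv_trans IHw.
apply: braid_equiv_cat; first exact: braid_equiv_refl.
apply: (@braid_equiv_cat _ [:: (i, e); (i, ~~ e)] [::]).
  exact: braid_equiv_cancel.
exact: braid_equiv_refl.
Qed.

Lemma braid_equiv_invl n (w : braid_word n) :
  braid_equiv (braid_word_inv w ++ w) [::].
Proof. by rewrite -{2}[w]braid_word_invK; apply: braid_equiv_invr. Qed.

Definition braid_one n : braid n := braid_of_word [::].

Definition braid_mul n (a b : braid n) : braid n :=
  braid_of_word (word_of_braid a ++ word_of_braid b).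

Definition braid_inv n (b : braid n) : braid n :=
  braid_of_word (braid_word_inv (word_of_braid b)).

Lemma word_of_braid_of_word n (w : braid_word n) :
  braid_equiv (word_of_braid (braid_of_word w)) w.
Proof. by apply/braid_of_wordP; rewrite word_of_braidK. Qed.

Lemma braid_of_word_cat n (w1 w2 : braid_word n) :
  braid_of_word (w1 ++ w2) = braid_mul (braid_of_word w1) (braid_of_word w2).
Proof.
apply/braid_of_wordP/braid_equiv_sym.
by apply: braid_equiv_cat; apply: word_of_braid_of_word.
Qed.

Lemma braid_mulA n : associative (@braid_mul n).
Proof.
move=> a b c.
rewrite -(word_of_braidK a) -(word_of_braidK b) -(word_of_braidK c).
by rewrite -!braid_of_word_cat catA.
Qed.

Lemma braid_mul1 n : left_id (@braid_one n) (@braid_mul n).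
Proof.
by move=> b; rewrite -(word_of_braidK b) -braid_of_word_cat.
Qed.

Lemma braid_mulr1 n : right_id (@braid_one n) (@braid_mul n).
Proof.
by move=> b; rewrite -(word_of_braidK b) -braid_of_word_cat cats0.
Qed.

Lemma braid_mulVr n : left_inverse (@braid_one n) (@braid_inv n) (@braid_mul n).
Proof.
move=> b; rewrite -{2}(word_of_braidK b) -braid_of_word_cat.
exact/braid_of_wordP/braid_equiv_invl.
Qed.

Lemma braid_mulrV n :
  right_inverse (@braid_one n) (@braid_inv n) (@braid_mul n).
Proof.
move=> b; rewrite -{1}(word_of_braidK b) -braid_of_word_cat.
exact/braid_of_wordP/braid_equiv_invr.
Qed.

HB.instance Definition _ n := isGroup.Build (braid n)
  (@braid_mulA n) (@braid_mul1 n) (@braid_mulr1 n)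
  (@braid_mulVr n) (@braid_mulrV n).

Definition sigma n (i : 'I_n.-1) : braid n := braid_of_word [:: (i, false)].

Definition positive_braid n (b : braid n) : Prop :=
  exists w : seq 'I_n.-1, b = \prod_(i <- w) sigma i.

(* The product is taken in increasing order of i.                             *)
Definition delta n : braid n := \prod_(i < n.-1) sigma i.

Definition full_twist n : braid n := delta n ^+ n.

Definition positive_root n : set (braid n) :=
  [set b | positive_braid b /\ b ^+ n = full_twist n]%classic.

(* Main.v *)
Require Import Defs.
From mathcomp Require Import all_boot.
From mathcomp Require Import boolp classical_sets functions cardinality.
From mathcomp Require Import ssralg ssrint zify.

Set Implicit Arguments.
Unset Strict Implicit.
Unset Printing Implicit Defensive.

(** A positive word all of whose letters are distinct and which uses every
    generator is a Coxeter element of the Artin group; the theorem says that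
    the positive [n]-th roots of the full twist are exactly these, and counts
    them.

    A positive root is a Coxeter element.  Two positive words that represent
    the same braid have the same length and use the same letters
    ([size_prod_sigma], [mem_prod_sigma]).  The length is the exponent sum.
    For the letters, colour the strands by whether they start among the first
    [i] positions; the signed number of crossings between strands of different
    colours is an invariant of the braid, and for a positive word it vanishes
    if and only if the word does not use the [i]-th generator, the only one
    that can mix the two groups of strands.  Applying this to [w ^ n] and
    [delta ^ n] shows that [w] has [n - 1] letters and uses each of the
    [n - 1] generators, hence uses each of them once ([root_word_perm]).

    Coxeter elements are conjugate to [delta], hence are roots.  Since
    generators at distance at least two commute, the largest letter of such a
    word can be moved to one of its two ends, so a Coxeter element is described
    by a sequence of [n - 2] bits, telling for each new generator on which side
    it is put ([coxeter], [prod_perm_coxeter]).  Passing from one side to the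
    other is a conjugation that does not disturb the generators that are still
    to come ([coxeter_conj]).  As [delta ^ n] is central
    ([full_twist_central]), every conjugate of [delta] is an [n]-th root of it.

    Different bit sequences give different braids: the permutations of the
    strands already differ, and the image of a suitable strand reveals the last
    bit, after which the last generator can be cancelled ([coxeter_inj]).  This
    gives [2 ^ (n - 2)] roots. *)

Local Open Scope group_scope.

(** * Coxeter elements in a group with the type A relations *)

Section ArtinGroup.

(** Generators are indexed by all natural numbers, so that index arithmetic
    needs no bounds; the braid relation between neighbours is only asked of the
    [N] first ones. *)
Variables (G : groupType) (s : nat -> G) (N : nat).
Hypothesis s_far : forall i j, (i.+1 < j)%N -> commute (s i) (s j).
Hypothesis s_near : forall i, (i.+1 < N)%N ->
  s i * s i.+1 * s i = s i.+1 * s i * s i.+1.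

Definition dual_garside k : G := \prod_(0 <= i < k) s i.

Lemma dual_garsideS k : dual_garside k.+1 = dual_garside k * s k.
Proof. by rewrite /dual_garside big_nat_recr. Qed.

Lemma commute_dual_garside k j : (k < j)%N -> commute (s j) (dual_garside k).
Proof.
move=> lt_kj; rewrite /dual_garside big_nat_cond.
apply: commute_prod => i /andP[/andP[_ lt_ik] _].
by apply/commute_sym/s_far; lia.
Qed.

Lemma dual_garside_shift k i : (i.+1 < k <= N)%N ->
  dual_garside k * s i = s i.+1 * dual_garside k.
Proof.
elim: k => // k IHk /andP[]; rewrite ltnS leq_eqVlt => /predU1P[<-|lt_ik] lt_kN.
  rewrite !dual_garsideS -!mulgA (mulgA (s i)) s_near // -!mulgA.
  rewrite !(mulgA (dual_garside i)).
  by rewrite -commute_dual_garside // !mulgA.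
rewrite dual_garsideS -mulgA -(s_far lt_ik) mulgA IHk ?mulgA //; lia.
Qed.

(** Conjugation by [dual_garside N] shifts the indices, but sends the last
    generator outside the set of generators; it is the square that brings it
    back to the first one.  Together with [dual_garside_shift] this makes the
    [N.+1]-st power central. *)
Lemma dual_garside_wrap m : m.+1 = N ->
  dual_garside N * dual_garside N * s m =
  s 0 * (dual_garside N * dual_garside N).
Proof.
move=> defN; set d := dual_garside N; set d' := \prod_(0 <= i < m) s i.+1.
have d_r : d = dual_garside m * s m by rewrite /d -defN dual_garsideS.
have d_l : d = s 0 * d' by rewrite /d -defN /dual_garside big_nat_recl.
have d_shift : d * dual_garside m = d' * d.
  rewrite /d' /dual_garside.
  have: (m < N)%N by rewrite defN.
  elim: m {d' d_r d_l defN} => [|k IHk] lt_kN.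
    by rewrite !big_geq // mulg1 mul1g.
  rewrite !big_nat_recr //= mulgA IHk; last by lia.
  by rewrite -!mulgA dual_garside_shift //; lia.
by rewrite {4}d_r (mulgA d) d_shift !mulgA -d_l.
Qed.

(** Moving [s i] through the power: [N.-1 - i] factors raise its index to the
    last one, two factors wrap it around to [0], and the [i] others raise it
    back to [i]. *)
Lemma commute_full_twist i : (i < N)%N ->
  commute (dual_garside N ^+ N.+1) (s i).
Proof.
move=> lt_iN; set d := dual_garside N.
have shift k j : (j + k < N)%N -> d ^+ k * s j = s (j + k) * d ^+ k.
  elim: k => [|k IHk] lt_jkN; first by rewrite addn0 mulg1 mul1g.
  rewrite expgS -mulgA IHk ?mulgA; last by lia.
  by rewrite dual_garside_shift ?addnS //; lia.
have [m defN] : exists m, m.+1 = N by exists N.-1; lia.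
have -> : N.+1 = (i + (2 + (m - i)))%N by lia.
have := shift (m - i)%N i; have := shift i 0%N.
rewrite add0n subnKC; last by lia.
move=> shift0 shiftm.
rewrite /commute 2!expgnDr -!mulgA shiftm; last by lia.
by rewrite (mulgA d d) (mulgA (d * d)) dual_garside_wrap // !mulgA shift0.
Qed.

(** The head of [t] concerns the generator of largest index, so that removing
    it leaves a Coxeter element of the parabolic subgroup with one generator
    less. *)
Fixpoint coxeter (t : seq bool) : G :=
  if t is b :: t' then
    let: k := (size t').+1 in if b then coxeter t' * s k else s k * coxeter t'
  else s 0.

(** The only letter that does not commute with the largest one, [k.+1], is its
    neighbour [k].  It occurs once, so [k.+1] can be moved to the end of the
    word on the other side from [k]. *)
Lemma prod_perm_coxeter k (w : seq nat) : perm_eq w (iota 0 k.+1) ->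
  exists2 t, size t = k & \prod_(i <- w) s i = coxeter t.
Proof.
elim: k w => [|k IHk] w w_perm.
  by exists [::]; rewrite ?(perm_small_eq _ w_perm) //= big_seq1.
have kw : k.+1 \in w by rewrite (perm_mem w_perm) mem_iota; lia.
case/splitPr: w / kw w_perm => [a b] w_perm.
have ab_perm : perm_eq (a ++ b) (iota 0 k.+1).
  rewrite -(perm_cons k.+1) -cat1s perm_catCA cat1s (perm_trans w_perm) //.
  by rewrite -[k.+2]addn1 iotaD perm_catC.
have ab_uniq : uniq (a ++ b) by rewrite (perm_uniq ab_perm) iota_uniq.
have comm c : {subset c <= a ++ b} -> k \notin c ->
    commute (s k.+1) (\prod_(i <- c) s i).
  move=> sub_c k_c; rewrite big_seq_cond; apply: commute_prod => i.
  rewrite andbT => i_c; apply/commute_sym/s_far.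
  have := sub_c i i_c; rewrite (perm_mem ab_perm) mem_iota.
  by have : i != k by [apply: contraNneq k_c => <-]; lia.
have [t size_t prod_t] := IHk _ ab_perm.
have : (k \notin a) || (k \notin b).
  move: ab_uniq; rewrite cat_uniq => /and3P[_ /hasPn ab_disj _].
  by case: (boolP (k \in b)) => [/ab_disj/= ->|]; rewrite ?orbT.
case/orP => k_notin.
  exists (false :: t); rewrite /= ?size_t // -prod_t !big_cat big_cons /=.
  rewrite !mulgA -comm // => i i_a.
  by rewrite mem_cat i_a.
exists (true :: t); rewrite /= ?size_t // -prod_t !big_cat big_cons /=.
rewrite -!mulgA -comm // => i i_b.
by rewrite mem_cat i_b orbT.
Qed.

(** The commutation of [g] with the generators beyond the next one is what makes
    the induction work: adding the generator [s (size t).+1] on the right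
    commutes with conjugating by [g], while adding it on the left is corrected
    by a further conjugation by [dual_garside (size t).+1]. *)
Lemma coxeter_conj t : exists2 g, coxeter t = dual_garside (size t).+1 ^ g
  & forall j, (size t < j)%N -> commute (s j) g.
Proof.
elim: t => [|b t [g def_t comm_g]] /=.
  exists 1 => [|j _]; last exact: commute1.
  by rewrite conjg1 /dual_garside big_nat1.
have s_fix : s (size t).+1 ^ g = s (size t).+1.
  by apply/conjg_fixP/commgP/comm_g.
case: b; rewrite def_t -{1}s_fix -conjMg.
  by exists g => [|j lt_j]; rewrite ?dual_garsideS //; apply: comm_g; lia.
exists (dual_garside (size t).+1 * g) => [|j lt_j].
  rewrite [dual_garside _.+2]dual_garsideS conjgM; congr (_ ^ g).
  by rewrite conjgE -!mulgA mulKg.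
apply: commuteM; last by apply: comm_g; lia.
by apply: commute_dual_garside; lia.
Qed.

End ArtinGroup.

(** * The generators of the braid group *)

Section Generators.

Variable n : nat.
Implicit Types (i j : nat) (w : seq 'I_n.-1) (b : braid n).

(** The value [1] beyond the last generator keeps the far commutation relation
    true for all indices. *)
Definition gen i : braid n := oapp (@sigma n) 1 (insub i).

Lemma gen_ord (k : 'I_n.-1) : gen k = sigma k.
Proof. by rewrite /gen valK. Qed.

Lemma braid_of_wordM (u v : braid_word n) :
  braid_of_word u * braid_of_word v = braid_of_word (u ++ v).
Proof. by rewrite braid_of_word_cat. Qed.

Lemma gen_far i j : (i.+1 < j)%N -> commute (gen i) (gen j).
Proof.
move=> lt_ij; rewrite /gen; case: insubP => [i' _ def_i|_] /=; last first.
  exact/commute_sym/commute1.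
case: insubP => [j' _ def_j|_] /=; last exact/commute1.
rewrite /commute !braid_of_wordM.
by apply/braid_of_wordP/braid_equiv_far; rewrite /= def_i def_j.
Qed.

Lemma gen_near i : (i.+1 < n.-1)%N ->
  gen i * gen i.+1 * gen i = gen i.+1 * gen i * gen i.+1.
Proof.
move=> lt_i; have lt_i' : (i < n.-1)%N by apply: ltnW.
have -> : gen i = sigma (Ordinal lt_i') by rewrite -gen_ord.
have -> : gen i.+1 = sigma (Ordinal lt_i) by rewrite -gen_ord.
by rewrite /sigma !braid_of_wordM; apply/braid_of_wordP/braid_equiv_near.
Qed.

Lemma delta_gen : delta n = dual_garside gen n.-1.
Proof.
by rewrite /dual_garside big_mkord; apply: eq_bigr => i _; rewrite gen_ord.
Qed.

Lemma prod_sigma w : \prod_(i <- w) sigma i = \prod_(i <- map val w) gen i.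
Proof. by rewrite big_map; apply: eq_bigr => i _; rewrite gen_ord. Qed.

Lemma commute_braid (z : braid n) : (forall i : 'I_n.-1, commute z (sigma i)) ->
  forall b, commute z b.
Proof.
move=> comm_z b; rewrite -[b]word_of_braidK.
elim: (word_of_braid b) => [|[i e] w IHw]; first exact: commute1.
rewrite -cat1s -braid_of_wordM; apply: commuteM => //.
case: e; last exact: comm_z.
suff -> : braid_of_word [:: (i, true)] = (sigma i)^-1 by apply: commuteV.
apply/esym/mulg1_eq; rewrite braid_of_wordM.
by apply/braid_of_wordP; apply: braid_equiv_cancel.
Qed.

Lemma full_twist_central b : commute (full_twist n) b.
Proof.
apply: commute_braid => i; rewrite /full_twist delta_gen -gen_ord.
have -> : dual_garside gen n.-1 ^+ n = dual_garside gen n.-1 ^+ n.-1.+1.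
  by congr (_ ^+ _); have := ltn_ord i; lia.
exact: commute_full_twist gen_far gen_near _ (ltn_ord i).
Qed.

End Generators.

(** * Actions of the braid group *)

Section BraidAction.

(** An action is given by permutations [f i] of [X] that satisfy the braid
    relations, with inverses [g i].  Letters act from right to left. *)
Variables (n : nat) (X : Type) (f g : nat -> X -> X).
Hypothesis fK : forall i, cancel (f i) (g i).
Hypothesis gK : forall i, cancel (g i) (f i).
Hypothesis f_far : forall i j x, (i.+1 < j)%N -> f i (f j x) = f j (f i x).
Hypothesis f_near : forall i x,
  f i (f i.+1 (f i x)) = f i.+1 (f i (f i.+1 x)).

Definition word_action (w : braid_word n) (x : X) : X :=
  foldr (fun l => (if l.2 then g else f) (val l.1)) x w.

Definition braid_action (b : braid n) : X -> X := word_action (word_of_braid b).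

Lemma word_action_equiv w1 w2 :
  braid_equiv w1 w2 -> word_action w1 =1 word_action w2.
Proof.
elim=> {w1 w2} [||||i [] x|i j lt_ij x|i j def_j x] //=.
- by move=> w1 w2 _ IH x; rewrite IH.
- by move=> w1 w2 w3 _ IH12 _ IH23 x; rewrite IH12 IH23.
- move=> w1 w2 w3 w4 _ IH12 _ IH34 x.
  by rewrite /word_action !foldr_cat -!/(word_action _ _) IH34 IH12.
- exact: fK.
- exact: gK.
- exact: f_far.
- by rewrite def_j f_near.
Qed.

Lemma braid_action_word w : braid_action (braid_of_word w) =1 word_action w.
Proof. exact/word_action_equiv/word_of_braid_of_word. Qed.

Lemma braid_actionM a b x :
  braid_action (a * b) x = braid_action a (braid_action b x).
Proof.
rewrite {1}/braid_action (word_action_equiv (word_of_braid_of_word _)).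
by rewrite /word_action foldr_cat.
Qed.

Lemma braid_action_gen i x : (i < n.-1)%N -> braid_action (gen n i) x = f i x.
Proof.
by move=> lt_i; rewrite -[i]/(val (Ordinal lt_i)) gen_ord braid_action_word.
Qed.

Lemma braid_action_prod (w : seq 'I_n.-1) x :
  braid_action (\prod_(i <- w) sigma i) x = foldr (fun i => f (val i)) x w.
Proof.
elim: w => [|i w IHw]; first by rewrite big_nil braid_action_word.
by rewrite big_cons braid_actionM IHw braid_action_word.
Qed.

End BraidAction.

(** * Adjacent transpositions *)

Definition swap k p := if p == k then k.+1 else if p == k.+1 then k else p.

Lemma swapL k : swap k k = k.+1.
Proof. by rewrite /swap eqxx. Qed.

Lemma swapR k : swap k k.+1 = k.
Proof. by rewrite /swap eqxx; case: eqP; lia. Qed.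

Lemma swapD k p : p != k -> p != k.+1 -> swap k p = p.
Proof. by rewrite /swap => /negbTE-> /negbTE->. Qed.

Lemma leq_swap k p m : (k < m)%N -> (p <= m)%N -> (swap k p <= m)%N.
Proof. by rewrite /swap; do !case: eqP; lia. Qed.

Lemma swapK k : involutive (swap k).
Proof. by move=> p; rewrite /swap; do !case: eqP; lia. Qed.

Lemma swap_far i j p : (i.+1 < j)%N -> swap i (swap j p) = swap j (swap i p).
Proof. by move=> lt_ij; rewrite /swap; do !case: eqP; lia. Qed.

Lemma swap_near i p :
  swap i (swap i.+1 (swap i p)) = swap i.+1 (swap i (swap i.+1 p)).
Proof. by rewrite /swap; do !case: eqP; lia. Qed.

(** * Invariants of positive words *)

Section PositiveWords.

Variable n : nat.
Implicit Types w : seq 'I_n.-1.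

(** The exponent sum is an invariant because it is the action of the braid on the
    integers in which every generator is the translation by [1]. *)
Lemma size_prod_sigma w1 w2 :
  \prod_(i <- w1) sigma i = \prod_(i <- w2) sigma i -> size w1 = size w2.
Proof.
pose f (_ : nat) (c : int) := (c + 1)%R.
pose g (_ : nat) (c : int) := (c - 1)%R.
have fK i : cancel (f i) (g i) by move=> c; rewrite /f /g GRing.addrK.
have gK i : cancel (g i) (f i) by move=> c; rewrite /f /g GRing.subrK.
have act_size w : braid_action f g (\prod_(i <- w) sigma i) 0%R = size w.
  rewrite braid_action_prod //.
  by elim: w => //= i w ->; rewrite /f; lia.
by move=> eq_w; apply/eqP; rewrite -eqz_nat -!act_size eq_w.
Qed.

(** The colouring argument: with the first [i.+1] positions coloured, the
    letters other than [i] preserve the colouring and create no bicoloured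
    crossing, the first [i] to act creates one, and crossings of a positive word
    never cancel. *)
Lemma mem_prod_sigma w1 w2 :
  \prod_(i <- w1) sigma i = \prod_(i <- w2) sigma i -> w1 =i w2.
Proof.
(* A state is a two-colouring of the positions together with the signed number
   of crossings between strands of different colours met so far. *)
pose f (k : nat) (x : (nat -> bool) * int) : (nat -> bool) * int :=
  (x.1 \o swap k, (x.2 + Posz (x.1 k != x.1 k.+1)%N)%R).
pose g (k : nat) (x : (nat -> bool) * int) : (nat -> bool) * int :=
  (x.1 \o swap k, (x.2 - Posz (x.1 k != x.1 k.+1)%N)%R).
have fK i : cancel (f i) (g i).
  move=> [S c]; congr pair; first by apply/funext => p /=; rewrite swapK.
  rewrite /= swapL swapR eq_sym.
  lia.
have gK i : cancel (g i) (f i).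
  move=> [S c]; congr pair; first by apply/funext => p /=; rewrite swapK.
  rewrite /= swapL swapR eq_sym.
  lia.
have f_far i j x : (i.+1 < j)%N -> f i (f j x) = f j (f i x).
  case: x => S c lt_ij; congr pair.
    by apply/funext => p /=; rewrite (swap_far p lt_ij).
  by rewrite /= !swapD; try lia.
have f_near i x : f i (f i.+1 (f i x)) = f i.+1 (f i (f i.+1 x)).
  case: x => S c; congr pair.
    by apply/funext => p /=; rewrite swap_near.
  have e1 : swap i i.+2 = i.+2 by rewrite swapD; lia.
  have e2 : swap i.+1 i = i by rewrite swapD; lia.
  rewrite /= !(swapL, swapR, e1, e2).
  lia.
pose L (i p : nat) := (p <= i)%N.
have crossings (i : 'I_n.-1) w :
  let x := braid_action f g (\prod_(i <- w) sigma i) (L i, 0%R) in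
  exists2 c : nat, x.2 = c
    & if i \in w then (0 < c)%N : Prop else x.1 = L i /\ c = 0%N.
  rewrite /= braid_action_prod //.
  elim: w => [|k w [c]] /=; first by exists 0%N.
  case: (foldr _ _ w) => S _ /= -> def_c.
  exists (c + (S k != S k.+1))%N; first by [].
  rewrite inE; case: (i \in w) def_c => [|[-> ->]].
    by rewrite orbT; lia.
  rewrite orbF; have [->|neq_ik] := eqVneq i k.
    by rewrite /L leqnn ltnn.
  have {}neq_ik : (i : nat) != k by [].
  split; last by rewrite /L; lia.
  by apply/funext => p /=; rewrite /L /swap; do !case: eqP; lia.
move=> eq_w i; have [c1 def_c1 i_w1] := crossings i w1.
have [c2 def_c2 i_w2] := crossings i w2.
move: i_w1 i_w2; have -> : c1 = c2.
  by move: def_c1; rewrite eq_w def_c2 => -[].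
by case: (i \in w1); case: (i \in w2) => //; lia.
Qed.

End PositiveWords.

(** * Permutations of Coxeter elements *)

Section CoxeterPermutation.

Variable n : nat.

Definition perm_action := @braid_action n nat swap swap.

Lemma perm_actionM a b p :
  perm_action (a * b) p = perm_action a (perm_action b p).
Proof. exact: braid_actionM swapK swapK swap_far swap_near a b p. Qed.

Lemma perm_action_gen i p : (i < n.-1)%N -> perm_action (gen n i) p = swap i p.
Proof. exact: braid_action_gen swapK swapK swap_far swap_near i p. Qed.

Lemma leq_perm_action_coxeter t p m : (size t < m)%N -> (size t < n.-1)%N ->
  (p <= m)%N -> (perm_action (coxeter (gen n) t) p <= m)%N.
Proof.
elim: t p => [|b t IHt] p /= lt_tm lt_t le_p.
  by rewrite perm_action_gen // leq_swap.
have {}IHt q : (q <= m)%N -> (perm_action (coxeter (gen n) t) q <= m)%N.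
  by apply: IHt; apply: ltnW.
by case: b; rewrite perm_actionM perm_action_gen ?IHt // leq_swap ?IHt.
Qed.

Lemma perm_action_coxeter_fix t p : (size t < n.-1)%N -> ((size t).+1 < p)%N ->
  perm_action (coxeter (gen n) t) p = p.
Proof.
elim: t => [|b t IHt] /= lt_t lt_p.
  by rewrite perm_action_gen // /swap; do !case: eqP; lia.
have swap_p : swap (size t).+1 p = p.
  by rewrite /swap; move: lt_p => /=; do !case: eqP; lia.
have {}IHt := IHt (ltnW lt_t) (ltnW lt_p).
by case: b; rewrite perm_actionM perm_action_gen ?swap_p ?IHt.
Qed.

(** The position [(size t).+1] is the highest one that the letters of [t] can
    reach; the letter of largest index brings it down, and since that letter
    occurs only once, nothing brings it up again. *)
Lemma perm_action_coxeter_top t : (size t < n.-1)%N ->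
  (perm_action (coxeter (gen n) t) (size t).+1 <= size t)%N.
Proof.
case: t => [|b t] /= lt_t; first by rewrite perm_action_gen.
case: b; rewrite perm_actionM perm_action_gen //.
  by rewrite swapR leq_perm_action_coxeter // ltnW.
by rewrite perm_action_coxeter_fix ?swapR // ltnW.
Qed.

(** The head generator [k := (size t).+1] swaps [k] and [k.+1].  If it acts
    first, it sends [k] to [k.+1], which the rest fixes; if it acts last, the
    rest has already sent [k] strictly below [k], where it stays. *)
Lemma coxeter_head_action b t : ((size t).+1 < n.-1)%N ->
  b = (perm_action (coxeter (gen n) (b :: t)) (size t).+1 == (size t).+2).
Proof.
move=> lt_t; have lt_t' := ltnW lt_t.
case: b => /=; rewrite perm_actionM perm_action_gen //.
  by rewrite swapL perm_action_coxeter_fix // eqxx.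
have := perm_action_coxeter_top lt_t'.
by rewrite /swap; do !case: eqP; lia.
Qed.

Lemma coxeter_inj t1 t2 : size t1 = size t2 -> (size t1 < n.-1)%N ->
  coxeter (gen n) t1 = coxeter (gen n) t2 -> t1 = t2.
Proof.
elim: t1 t2 => [|b1 t1 IHt] [|b2 t2] //= [eq_size] lt_t eq_cox.
have def_b1 := coxeter_head_action b1 lt_t.
have lt_t2 : ((size t2).+1 < n.-1)%N by rewrite -eq_size.
have := coxeter_head_action b2 lt_t2.
rewrite -{1 2}eq_size /= -eq_cox -def_b1 => eq_b.
rewrite -{}eq_b in eq_cox *; congr cons.
apply: IHt (ltnW lt_t) _ => //.
by case: b2 eq_cox; rewrite /= eq_size => eq_cox;
  [apply: mulIg eq_cox | apply: mulgI eq_cox].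
Qed.

End CoxeterPermutation.

(** * Positive roots of the full twist *)

Lemma positive_coxeter n t : positive_braid (coxeter (gen n) t).
Proof.
have posM a b : positive_braid a -> positive_braid b -> positive_braid (a * b).
  by move=> [u ->] [v ->]; exists (u ++ v); rewrite big_cat.
have pos_gen i : positive_braid (gen n i).
  rewrite /gen; case: insubP => [k _ _|_] /=.
    by exists [:: k]; rewrite big_seq1.
  by exists [::]; rewrite big_nil.
by elim: t => [|[] t IHt] /=; [apply: pos_gen | apply: posM | apply: posM].
Qed.

Lemma prod_sigmaX n (w : seq 'I_n.-1) m :
  (\prod_(i <- w) sigma i) ^+ m = \prod_(i <- flatten (nseq m w)) sigma i.
Proof.
elim: m => [|m IHm]; first by rewrite big_nil.
by rewrite expgS IHm /= big_cat.
Qed.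

(** The power [n] only serves to reach a braid that is known: it multiplies the
    length by [n] and does not change the set of letters, so both can be
    compared with those of [delta]. *)
Lemma root_word_perm n (w : seq 'I_n.-1) : (0 < n)%N ->
  (\prod_(i <- w) sigma i) ^+ n = full_twist n -> perm_eq w (enum 'I_n.-1).
Proof.
have delta_enum : delta n = \prod_(i <- enum 'I_n.-1) sigma i.
  rewrite prod_sigma val_enum_ord delta_gen.
  by rewrite /dual_garside /index_iota subn0.
move=> n_gt0; rewrite /full_twist delta_enum !prod_sigmaX => eq_w.
have mem_flat (u : seq 'I_n.-1) : flatten (nseq n u) =i u.
  move=> i; case: (n) n_gt0 u i => // m _ u i.
  apply/flattenP/idP => [[v] |i_u].
    by rewrite mem_nseq => /andP[_ /eqP->].
  by exists u; rewrite ?mem_nseq ?eqxx.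
have size_flat (u : seq 'I_n.-1) : size (flatten (nseq n u)) = (n * size u)%N.
  by rewrite size_flatten /shape map_nseq sumn_nseq mulnC.
have w_all : w =i enum 'I_n.-1.
  by move=> i; rewrite -mem_flat (mem_prod_sigma eq_w) mem_flat.
have w_size : size w = size (enum 'I_n.-1).
  apply/eqP; rewrite -(eqn_pmul2l n_gt0) -!size_flat.
  by rewrite (size_prod_sigma eq_w).
apply: uniq_perm; rewrite ?enum_uniq //.
by rewrite (eq_uniq w_size w_all) enum_uniq.
Qed.

Lemma positive_rootP m (b : braid m.+2) :
  positive_root b <-> exists2 t, size t = m & b = coxeter (gen m.+2) t.
Proof.
split=> [[[w ->] root_w] | [t size_t ->]].
  have w_perm := root_word_perm (ltn0Sn _) root_w.
  have : perm_eq (map val w) (iota 0 m.+1) by rewrite -val_enum_ord perm_map.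
  case/(prod_perm_coxeter (@gen_far m.+2)) => t size_t def_t.
  by exists t; rewrite // prod_sigma.
split; first exact: positive_coxeter.
have [g -> _] := coxeter_conj (@gen_far m.+2) t.
rewrite size_t -conjXg -[dual_garside _ _]delta_gen.
by apply/conjg_fixP/commgP/full_twist_central.
Qed.

Theorem theorem2p1 (n : nat) (hn : (2 <= n)%N) :
  (@positive_root n #= `I_(2 ^ (n - 2))%N)%card /\
  (forall b : braid n, @positive_root n b ->
     exists c : braid n, b = (delta n ^ c)%g).
Proof.
case: n hn => [|[|m]] // _; rewrite subn2 /=; split; last first.
  move=> b /positive_rootP[t size_t ->].
  have [g -> _] := coxeter_conj (@gen_far m.+2) t.
  by exists g; rewrite size_t delta_gen.
have <- : #|{: m.-tuple bool}| = (2 ^ m)%N by rewrite card_tuple card_bool.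
(* The bit sequences are enumerated so that the roots become the range of a
   function on an ordinal. *)
pose cox (k : 'I_#|{: m.-tuple bool}|) := coxeter (gen m.+2) (enum_val k).
have -> : @positive_root m.+2 = range cox.
  apply/seteqP; split=> b /=.
    case/positive_rootP => t /eqP size_t ->.
    by exists (enum_rank (Tuple size_t)); rewrite // /cox enum_rankK.
  move=> [k _ <-]; apply/positive_rootP.
  by exists (enum_val k); rewrite ?size_tuple.
have cox_inj : injective cox.
  move=> k1 k2 eq_cox; apply/enum_val_inj/val_inj.
  by apply: coxeter_inj eq_cox; rewrite ?size_tuple.
apply: card_eq_trans (card_esym card_II).
by apply: inj_card_eq => k1 k2 _ _ /cox_inj.
Qed.
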